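(* Let $S$ be a finite semigroup, let $\mathcal A(S)=(S,Q(S),\iota,\cdot)$ be the automaton defined in the context (for any choice of the idempotents $E_X$ and of the permutations $g_{(s,R)}$), and let $\Phi=\mathrm{val}:Q(S)\setminus\{\iota\}\to\mathcal P(S)$, $(X,d,g)\mapsto\bigcup([X]_{\mathrm{II}}\odot d^{-1}g)$. Then $\Phi$ is a flow, that is, $s\in(\iota\cdot s)\Phi$ and $(q)\Phi\cdot\{s\}\subseteq(q\cdot s)\Phi$ for all $s\in S$ and all $q\in Q(S)\setminus\{\iota\}$. Consequently $(S,\mathcal A(S),\Phi)$ is a flow automaton, and its cover complex satisfies $\mathrm{Cov}(S,\mathcal A(S),\Phi)\subseteq\mathsf C_{\mathbf{ER}}(S)$.
   Context: A flow automaton is a triple $(S,\mathcal A,\Phi)$ where $S$ is a finite semigroup, $\mathcal A=(S,Q,\iota,\cdot)$ is an automaton with input symbols $S$, finite state set $Q$, initial state $\iota\in Q$ and transition function $Q\times S\to Q$, and $\Phi:Q\setminus\{\iota\}\to\mathcal P(S)$ is a function (a flow) with $s\in(\iota\cdot s)\Phi$ and $(q)\Phi\cdot\{s\}\subseteq(q\cdot s)\Phi$ for all $s\in S$, $q\in Q\setminus\{\iota\}$. Its cover complex is $\mathrm{Cov}(S,\mathcal A,\Phi)=\{X\in\mathcal P(S): X\subseteq(q)\Phi\text{ for some }q\in Q\setminus\{\iota\}\}$. Maps are written on the right. For a finite semigroup $T$: $T^I$ is $T$ with a new identity element $I$ adjoined; $E(T)$ is the set of idempotents; $x^\omega$ is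 the unique idempotent power of $x$; $x\le_{\mathcal R}y$ iff $x\in yT^I$, $<_{\mathcal R}$ is its strict version, and $\mathcal R$ the induced equivalence, with $R_x$ the $\mathcal R$-class of $x$; $J_x$ is the $\mathcal J$-class of $x$. $K_{\mathbf G}(T)$ (group kernel) is the set of $x\in T$ such that $(x,1_G)\in\rho$ for every finite group $G$ and every subsemigroup $\rho\subseteq T\times G$ projecting onto $T$. Type-II partition on $T$: $x\equiv_{\mathrm{II}}y$ iff $xa=y$, $yb=x$ for some $a,b\in K_{\mathbf G}(T)^I$; $[x]_{\mathrm{II}}$ is the class of $x$. It is contained in $\mathcal R$. For an $\mathcal R$-class $R$, $R/\mathrm{II}$ is the set of type-II classes in $R$, on which $T$ acts by partial injections: $[x]_{\mathrm{II}}\ast s=[x's]_{\mathrm{II}}$ if some $x'\equiv_{\mathrm{II}}x$ has $x's\in R$, and undefined otherwise (this is well defined). Right activator: for a $\mathcal J$-class $J$ of $T$, $\mathrm{RAct}(J)$ is the unique $\le_{\mathcal J}$-minimal $\mathcal J$-class of $T^I$ contained in $\{a\in T^I: Ja\cap J\ne\varnothing\}$. For $x\in T$, $\mathcal F_x$ is the set of $t\in\mathrm{RAct}(J_x)$ such that (1) $xt=x$; (2) for all $s\in T$, $xs<_{\mathcal R}x$ iff $ts<_{\mathcal R}t$; (3) left multiplication by $x$ maps $R_t$ onto $R_x$. $\mathcal F_x$ always contains an idempotent. Let $S$ be a finite semigroup. $\mathcal P(S)$ is the semigroup of non-empty subsets of $S$ under setwise product. An $S$-complex is a subsemigroup of $\mathcal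 P(S)$ containing all singletons and closed under non-empty subsets of members. $C=\mathsf C_{\mathbf{ER}}(S)$ is the intersection of all $S$-complexes $\mathcal K$ such that $\bigcup[E]_{\mathrm{II}}\in\mathcal K$ for every idempotent $E$ of the semigroup $\mathcal K$, with $[E]_{\mathrm{II}}$ computed in $\mathcal K$; it is itself the smallest such complex. For $X\in C$, $(X)\beta=\bigcup[X]_{\mathrm{II}}$ (class computed in the semigroup $C$), which lies in $C$; also $(I)\beta=I$. For each $X\in C$ choose an idempotent $E_X\in\mathcal F_X$ (computed in $C$), with $E_F=F$ if $F$ is idempotent, and put $(X)\psi=X\cdot((E_X)\beta)^\omega$. Let $\overline X=(X)\psi^\omega$, where $\psi^\omega$ is the idempotent power of the self-map $\psi$ of $C$. Let $\mathbb F=\{X\in C:(X)\psi=X\}$ and $\mathbb B=\{[X]_{\mathrm{II}}:X\in\mathbb F\}=\{\pi\in C/\mathrm{II}:\bigcup\pi\in\pi\}$. Groups: for each $\mathcal R$-class $R$ of $C$ and $s\in S$, choose a permutation $g_{(s,R)}$ of $R/\mathrm{II}$ extending the partial injection $[X]_{\mathrm{II}}\mapsto[X]_{\mathrm{II}}\ast\{s\}$. Let $\mathscr R=\{R_X:X\in\mathbb F\}$, $g_s=(g_{(s,R)})_{R\in\mathscr R}$, and let $\mathbb G$ be the (finite) group generated by $\{g_s : s\in S\}$ in the product over $R\in\mathscr R$ of the symmetric groups on $R/\mathrm{II}$. $\mathbb G$ acts on the right on $\bigcup_{R\in\mathscr R}R/\mathrm{II}$ componentwise, written $[X]_{\mathrm{II}}\odot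 g$. Automaton: $Q(S)=\{(X,d,g)\in\mathbb F\times\mathbb G\times\mathbb G:[X]_{\mathrm{II}}\odot d^{-1}g\in\mathbb B\}\cup\{\iota\}$ with initial state $\iota$. For $(X,d,g)\in Q(S)\setminus\{\iota\}$, set $\mathrm{val}(X,d,g)=\bigcup([X]_{\mathrm{II}}\odot d^{-1}g)\in\mathbb F$. For $s\in S$ define $\lambda_s:Q(S)\setminus\{\iota\}\to\mathbb F\times\mathbb G$ by $(X,d,g)\lambda_s=(X,d)$ if $\mathrm{val}(X,d,g)\cdot\{s\}\ \mathcal R\ \mathrm{val}(X,d,g)$ in $C$ and $(X,d,gg_s)\in Q(S)$, and $(X,d,g)\lambda_s=(\overline{\mathrm{val}(X,d,g)\cdot\{s\}},\,gg_s)$ otherwise. The transitions are $\iota\cdot s=(\overline{\{s\}},g_s,g_s)$ and $(X,d,g)\cdot s=((X,d,g)\lambda_s,\,gg_s)$, which always lie in $Q(S)\setminus\{\iota\}$. *)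

(* Defs.v *)
From HB Require Import structures.
From mathcomp Require Import all_boot all_fingroup.
From mathcomp Require Import boolp.

Set Implicit Arguments.
Unset Strict Implicit.
Unset Printing Implicit Defensive.

Local Open Scope group_scope.

(* HB rejects a join of [finType] and [semigroupType] declared after fingroup
   (missing join with [finStarMonoidType]); hence a separate structure. *)
HB.mixin Record Finite_isSemigroup T of Finite T := {
  smul : T -> T -> T;
  smulA : associative smul
}.

#[short(type="finSemigroupType")]
HB.structure Definition FinSemigroup := {T of Finite T & Finite_isSemigroup T}.

Infix "**" := smul (at level 40, left associativity) : group_scope.

Section IdempotentPower.
Variable T : finSemigroupType.
Implicit Types x : T.

Definition idem x := x ** x == x.

(* x to the power n + 1 *)
Definition pow1 x n : T := iter n (smul x) x.

Lemma pow1D x m n : pow1 x m ** pow1 x n = pow1 x (m + n).+1.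
Proof. by elim: m => // m IHm; rewrite /= -smulA -/(pow1 x m) IHm. Qed.

Lemma ex_idem_pow1 x : exists n, idem (pow1 x n).
Proof.
have [i [j [ltij eqij]]] : exists i j, i < j /\ pow1 x i = pow1 x j.
  pose f (k : 'I_#|T|.+1) := pow1 x k.
  have /injectivePn[k [l neq_kl eq_kl]] : ~~ injectiveb f.
    by apply/injectiveP => /leq_card; rewrite card_ord ltnn.
  have [ltkl|ltlk|/ord_inj eqkl] := ltngtP k l.
  - by exists k, l.
  - by exists l, k.
  - by rewrite eqkl eqxx in neq_kl.
pose p := (j - i)%N.
have p_gt0 : 0 < p by rewrite subn_gt0.
have shift1 m : i <= m -> pow1 x (m + p) = pow1 x m.
  move=> /subnK <-; case: (m - i)%N => [|d]; first by rewrite add0n subnKC // ltnW.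
  by rewrite -addnA subnKC ?(ltnW ltij) // !addSn -!pow1D eqij.
have shift k m : i <= m -> pow1 x (m + k * p) = pow1 x m.
  move=> le_im; elim: k => [|k IHk]; first by rewrite mul0n addn0.
  by rewrite mulSn (addnC p) addnA shift1 // (leq_trans le_im) // leq_addr.
exists (i.+1 * p).-1; set m := (i.+1 * p).-1.
have mE : m.+1 = (i.+1 * p)%N by rewrite prednK // muln_gt0.
apply/eqP; rewrite pow1D -addnS mE shift //.
by rewrite -ltnS mE leq_pmulr.
Qed.

Definition omega x : T := pow1 x (ex_minn (ex_idem_pow1 x)).

Lemma idem_omega x : idem (omega x).
Proof. by rewrite /omega; case: ex_minnP. Qed.

End IdempotentPower.

(* Self-maps of a finite set, written on the right: x(fg) = (xf)g. *)
Section SelfMap.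
Variable T : finType.
Definition ffun_smul (f g : {ffun T -> T}) : {ffun T -> T} := [ffun x => g (f x)].
Lemma ffun_smulA : associative ffun_smul.
Proof. by move=> f g h; apply/ffunP => x; rewrite !ffunE. Qed.
HB.instance Definition _ := Finite_isSemigroup.Build {ffun T -> T} ffun_smulA.
End SelfMap.

(* [option T] is the semigroup T^I, with I = None. *)
Section AdjoinIdentity.
Variable T : finSemigroupType.
Definition option_smul (x y : option T) : option T :=
  match x, y with
  | Some a, Some b => Some (a ** b)
  | None, _ => y
  | _, None => x
  end.
Lemma option_smulA : associative option_smul.
Proof. by move=> [x|] [y|] [z|] //=; rewrite smulA. Qed.
HB.instance Definition _ := Finite_isSemigroup.Build (option T) option_smulA.
End AdjoinIdentity.

(* All subsets of S, including set0; P(S) is the subsemigroup [nePow S]. *)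
Section PowerSemigroup.
Variable S : finSemigroupType.
Definition set_smul (X Y : {set S}) : {set S} := [set x ** y | x in X, y in Y].
Lemma set_smulA : associative set_smul.
Proof.
move=> X Y Z; apply/setP=> u; apply/imset2P/imset2P.
- case=> x v xX /imset2P[y z yY zZ ->] ->; exists (x ** y) z => //.
    by apply/imset2P; exists x y.
  by rewrite smulA.
- case=> v z /imset2P[x y xX yY ->] zZ ->; exists x (y ** z) => //.
    by apply/imset2P; exists y z.
  by rewrite smulA.
Qed.
HB.instance Definition _ := Finite_isSemigroup.Build {set S} set_smulA.
Definition nePow : {set {set S}} := [set X | X != set0].
End PowerSemigroup.

Arguments nePow S : clear implicits.

(* Green's relations, the group kernel, etc. of a subsemigroup A of T, computed
   in A (not in T). *)
Section Green.
Variables (T : finSemigroupType) (A : {set T}).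
Implicit Types (x y : T) (a b : option T).

(* A^I *)
Definition adjI : {set option T} := None |: [set Some x | x in A].

(* the product x a, with x in T and a in T^I *)
Definition mulI x a : T := if a is Some y then x ** y else x.

Definition leR x y := [exists a in adjI, x == mulI y a].
Definition ltR x y := leR x y && ~~ leR y x.
Definition eqR x y := leR x y && leR y x.
Definition Rclass x := [set y in A | eqR x y].

Definition leJ x y :=
  [exists a in adjI, exists b in adjI, Some x == a ** Some y ** b].
Definition eqJ x y := leJ x y && leJ y x.
Definition Jclass x := [set y in A | eqJ x y].

(* rho is a subsemigroup of A x gT projecting onto A *)
Definition onto_subsemigroup (gT : finGroupType) (rho : {set T * gT}) :=
  [set p.1 | p in rho] = A /\
  {in rho &, forall p q, (p.1 ** q.1, p.2 * q.2) \in rho}.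

Definition group_kernel : {set T} :=
  [set x in A | `[< forall (gT : finGroupType) (rho : {set T * gT}),
                     onto_subsemigroup rho -> (x, 1) \in rho >] ].

End Green.

Section TypeII.
Variables (T : finSemigroupType) (A : {set T}).
Implicit Types (x y s : T) (R J pi : {set T}).

Definition eqII x y :=
  [exists a in adjI (group_kernel A), mulI x a == y] &&
  [exists b in adjI (group_kernel A), mulI y b == x].
Definition classII x := [set y in A | eqII x y].

Definition quoII R := [set classII x | x in R].

(* the graph of the partial map pi |-> pi * s on R/II *)
Definition actII R s pi (pi' : {set T}) :=
  exists2 x, x \in pi & x ** s \in R /\ pi' = classII (x ** s).

Definition activators J : {set option T} :=
  [set a in adjI A | [exists x in J, mulI x a \in J]].

(* The union of the <=_J-minimal J-classes of A^I contained in [activators J];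
   there is exactly one such J-class. *)
Definition RAct J : {set option T} :=
  let AI := adjI A in
  [set a in AI | (Jclass AI a \subset activators J) &&
     [forall b in AI,
        (Jclass AI b \subset activators J) && leJ AI b a ==> leJ AI a b]].

(* Here <_R and R_t, for t in T^I, are computed in the semigroup A^I. *)
Definition calF x : {set option T} :=
  let AI := adjI A in
  [set t in RAct (Jclass A x) |
    [&& mulI x t == x,
        [forall s in A, ltR A (x ** s) x == ltR AI (t ** Some s) t]
      & [set mulI x u | u in Rclass AI t] == Rclass A x]].

End TypeII.

Section Complex.
Variable S : finSemigroupType.
Implicit Types K : {set {set S}}.

Definition is_complex K :=
  [&& K \subset nePow S,
      [forall s, [set s] \in K],
      [forall X in K, forall Y in K, X ** Y \in K]
    & [forall X in K, forall Y in nePow S, (Y \subset X) ==> (Y \in K)]].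

Definition is_ER_complex K :=
  is_complex K && [forall E in K, idem E ==> (cover (classII K E) \in K)].

Definition CER : {set {set S}} := \bigcap_(K | is_ER_complex K) K.

End Complex.

Arguments CER S : clear implicits.

Section FlowAutomaton.
Variables (S : finSemigroupType) (St : finType).
(* The state set is Q; St is only an ambient type. *)
Variables (Q : {set St}) (iota : St) (step : St -> S -> St).
Variable Phi : St -> {set S}.

Definition is_automaton :=
  iota \in Q /\ (forall q s, q \in Q -> step q s \in Q).

(* Phi stands for a map Q \ {iota} -> P(S). The flow conditions evaluate Phi at
   the states q.s, so these must differ from iota. *)
Definition is_flow :=
  [/\ forall q, q \in Q :\ iota -> Phi q \in nePow S,
      forall q s, q \in Q -> step q s \in Q :\ iota,
      forall s, s \in Phi (step iota s)
    & forall q s, q \in Q :\ iota -> Phi q ** [set s] \subset Phi (step q s)].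

Definition is_flow_automaton := is_automaton /\ is_flow.

Definition Cov : {set {set S}} :=
  [set X in nePow S | [exists q in Q :\ iota, X \subset Phi q]].

End FlowAutomaton.

Section Construction.
Variable S : finSemigroupType.
Local Notation C := (CER S).

Definition beta (X : {set S}) : {set S} := cover (classII C X).

(* E X is the idempotent E_X of C^I; values outside C are irrelevant. *)
Definition idempotent_choice (E : {set S} -> option {set S}) :=
  {in C, forall X, [/\ E X \in calF C X, idem (E X) & idem X -> E X = Some X]}.

(* g s R is the permutation g_(s,R) of R/II, for R an R-class of C. *)
Definition permutation_choice
    (g : S -> {set {set S}} -> {perm {set {set S}}}) :=
  forall s R, R \in [set Rclass C X | X in C] ->
    g s R \in Sym (quoII C R) /\
    {in quoII C R, forall pi pi', actII C R [set s] pi pi' -> g s R pi = pi'}.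

Variables (E : {set S} -> option {set S}).
Variables (g : S -> {set {set S}} -> {perm {set {set S}}}).

Definition psi (X : {set S}) : {set S} := mulI X (omega (omap beta (E X))).

(* Since psi maps C to C, the idempotent power of psi as a self-map of {set S}
   restricts to that of psi as a self-map of C. *)
Definition bar (X : {set S}) : {set S} := omega [ffun Y => psi Y] X.

Definition FF : {set {set S}} := [set X in C | psi X == X].
Definition BB : {set {set {set S}}} := [set classII C X | X in FF].
Definition scrR : {set {set {set S}}} := [set Rclass C X | X in FF].

(* Contains the product over R in scrR of the symmetric groups on R/II, as those
   are the subgroups [Sym (quoII C R)]. *)
Definition prodG : finGroupType :=
  {dffun forall _ : {R | R \in scrR}, {perm {set {set S}}}}.

Definition gen (s : S) : prodG := [ffun R => g s (val R)].
Definition GG : {set prodG} := <<[set gen s | s : S]>>.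

(* The classes of II contained in distinct R-classes are distinct, so at most one
   R is picked; the default value is not used. *)
Definition odot (pi : {set {set S}}) (h : prodG) : {set {set S}} :=
  if [pick R : {R | R \in scrR} | pi \in quoII C (val R)] is Some R
  then h R pi else pi.

Definition state : finType := option ({set S} * prodG * prodG).

Definition iotaS : state := None.

Definition in_QS (X : {set S}) (d h : prodG) :=
  [&& X \in FF, d \in GG, h \in GG & odot (classII C X) (d^-1 * h) \in BB].

Definition QS : {set state} :=
  [set q : state | if q is Some (X, d, h) then in_QS X d h else true].

Definition value (X : {set S}) (d h : prodG) : {set S} :=
  cover (odot (classII C X) (d^-1 * h)).

Definition lambda (X : {set S}) (d h : prodG) (s : S) : {set S} * prodG :=
  if eqR C (value X d h ** [set s]) (value X d h) && in_QS X d (h * gen s)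
  then (X, d)
  else (bar (value X d h ** [set s]), h * gen s).

Definition stepS (q : state) (s : S) : state :=
  if q is Some (X, d, h) then Some (lambda X d h s, h * gen s)
  else Some (bar [set s], gen s, gen s).

(* the value at the initial state is not used *)
Definition PhiS (q : state) : {set S} :=
  if q is Some (X, d, h) then value X d h else set0.

End Construction.

Arguments QS {S} E g.
Arguments iotaS {S} E.
Arguments stepS {S} E g q s.
Arguments PhiS {S} E q.

(* Main.v *)
Require Import Defs.
From mathcomp Require Import all_boot all_fingroup.
From mathcomp Require Import boolp.

Set Implicit Arguments.
Unset Strict Implicit.
Unset Printing Implicit Defensive.

Local Open Scope group_scope.

(** The crux is that [beta X] is contained in [psi X] for every [X] in [C].
Let [X a] be type-II equivalent to [X], with [a] in the group kernel.  Since
[E_X] lies in [calF X], right multiplication by [a] keeps [E_X] in its R-class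
as it keeps [X] in its own, and an R-equivalence realised by a group kernel
element is a type-II equivalence; thus [X a = X (E_X a)] is contained in
[X (beta E_X)], hence in [psi X].  It follows that a fixed point of [psi] is the
union of its type-II class.  As [psi] is moreover extensive, [bar X] is a fixed
point containing [X].  The value [V] of a state is a fixed point, and the next
state has as value either the union of the class of [V s] or [bar (V s)]; both
contain [V s]. *)

Definition smul_closed (T : finSemigroupType) (A : {set T}) :=
  {in A &, forall x y, x ** y \in A}.

Section Powers.
Variable T : finSemigroupType.
Implicit Types (x y : T) (A : {set T}).

Lemma mem_pow1 A x n : smul_closed A -> x \in A -> pow1 x n \in A.
Proof. by move=> mulA xA; elim: n => //= n; apply: mulA. Qed.

Lemma mem_omega A x : smul_closed A -> x \in A -> omega x \in A.
Proof. exact: mem_pow1. Qed.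

Lemma smul_pow1_id x y n : x ** y = x -> x ** pow1 y n = x.
Proof. by move=> xy; elim: n => //= n; rewrite smulA xy. Qed.

Lemma pow1_Some x n : pow1 (Some x) n = Some (pow1 x n).
Proof. by elim: n => //= n ->. Qed.

Lemma omega_Some x : omega (Some x) = Some (omega x).
Proof.
rewrite /omega pow1_Some; congr (Some (pow1 _ _)).
by apply: eq_ex_minn => n; rewrite pow1_Some.
Qed.

Lemma omega_None : omega None = None :> option T.
Proof. by rewrite /omega; elim: (ex_minn _) => //= n ->. Qed.

End Powers.

Section SelfMapPowers.
Variables (T : finType) (f : T -> T).

Lemma omega_ffun_iter : exists n, omega [ffun x => f x] =1 iter n.+1 f.
Proof.
exists (ex_minn (ex_idem_pow1 [ffun x => f x])) => x; rewrite /omega.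
elim: (ex_minn _) x => [|n IHn] x; first by rewrite ffunE.
by rewrite [LHS]ffunE -/(pow1 _ n) IHn ffunE -iterSr.
Qed.

Lemma omega_ffun_idem x :
  omega [ffun y => f y] (omega [ffun y => f y] x) = omega [ffun y => f y] x.
Proof. by have /eqP/ffunP/(_ x) := idem_omega [ffun y => f y]; rewrite ffunE. Qed.

Lemma mem_omega_ffun (D : {pred T}) :
  {homo f : x / x \in D} -> {homo omega [ffun x => f x] : x / x \in D}.
Proof. by move=> fD x xD; have [n ->] := omega_ffun_iter; apply: iter_in. Qed.

Section Extensive.
Variables (r : rel T) (D : {pred T}).
Hypotheses (r_refl : reflexive r) (r_trans : transitive r).
Hypothesis fD : {homo f : x / x \in D}.
Hypothesis f_ext : {in D, forall x, r x (f x)}.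

Lemma iter_extensive n : {in D, forall x, r x (iter n f x)}.
Proof.
move=> x xD; elim: n => //= n /r_trans; apply.
by apply: f_ext; apply: iter_in.
Qed.

Lemma omega_extensive : {in D, forall x, r x (omega [ffun y => f y] x)}.
Proof.
by move=> x; have [n ->] := omega_ffun_iter; apply: iter_extensive.
Qed.

Lemma omega_extensive_fixed : antisymmetric r ->
  {in D, forall x, f (omega [ffun y => f y] x) = omega [ffun y => f y] x}.
Proof.
move=> r_anti x xD; set y := (X in f X).
have yD : y \in D by apply: mem_omega_ffun.
apply: r_anti; rewrite [X in _ && X]f_ext // andbT.
have [n fn] := omega_ffun_iter; rewrite -[X in r _ X]omega_ffun_idem fn iterSr.
by apply: iter_extensive; apply: fD.
Qed.

End Extensive.
End SelfMapPowers.

Section AdjoinedIdentity.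
Variables (T : finSemigroupType) (A : {set T}).

Lemma mulIA x (a b : option T) : mulI (mulI x a) b = mulI x (a ** b).
Proof. by case: a b => [a|] [b|] //=; rewrite smulA. Qed.

Lemma mem_adjI_Some x : (Some x \in adjI A) = (x \in A).
Proof. by rewrite !inE mem_imset //; apply: Some_inj. Qed.

Lemma mem_adjI_None : None \in adjI A.
Proof. by rewrite !inE. Qed.

Lemma smul_closed_adjI : smul_closed A -> smul_closed (adjI A).
Proof. by move=> mulA [x|] [y|] //; rewrite !mem_adjI_Some; apply: mulA. Qed.

End AdjoinedIdentity.

Lemma adjIS (T : finSemigroupType) (A B : {set T}) :
  A \subset B -> adjI A \subset adjI B.
Proof. by move=> sAB; rewrite setUS // imsetS. Qed.

Section GreenR.
Variables (T : finSemigroupType) (A : {set T}).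
Hypothesis mulA : smul_closed A.
Implicit Types x y z s : T.

Lemma leR_refl x : leR A x x.
Proof. by apply/existsP; exists None; rewrite mem_adjI_None /=. Qed.

Lemma leR_trans y x z : leR A x y -> leR A y z -> leR A x z.
Proof.
case/exists_inP=> a aA /eqP-> /exists_inP[b bA /eqP->].
by apply/exists_inP; exists (b ** a); rewrite ?mulIA // smul_closed_adjI.
Qed.

Lemma leR_mulr x s : s \in A -> leR A (x ** s) x.
Proof. by move=> sA; apply/exists_inP; exists (Some s); rewrite ?mem_adjI_Some. Qed.

Lemma ltR_mulr x s : s \in A -> ltR A (x ** s) x = ~~ leR A x (x ** s).
Proof. by move=> sA; rewrite /ltR leR_mulr. Qed.

Lemma eqR_refl x : eqR A x x.
Proof. by rewrite /eqR leR_refl. Qed.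

Lemma eqR_sym x y : eqR A x y = eqR A y x.
Proof. by rewrite /eqR andbC. Qed.

Lemma eqR_trans y x z : eqR A x y -> eqR A y z -> eqR A x z.
Proof.
by move=> /andP[xy yx] /andP[yz zy]; rewrite /eqR (leR_trans xy) ?(leR_trans zy).
Qed.

Lemma mem_Rclass x : x \in A -> x \in Rclass A x.
Proof. by move=> xA; rewrite inE xA eqR_refl. Qed.

Lemma eq_Rclass x y : eqR A x y -> Rclass A x = Rclass A y.
Proof.
move=> xy; apply/setP=> z; rewrite !inE; case: (z \in A) => //=.
by apply/idP/idP; apply: eqR_trans; rewrite // eqR_sym.
Qed.

Lemma leR_adjI_Some x y : leR (adjI A) (Some x) (Some y) = leR A x y.
Proof.
apply/exists_inP/exists_inP=> [[[a|] aA /eqP xy]|[a aA /eqP->]].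
- by rewrite mem_adjI_Some in aA; exists a => //; case: a xy {aA} => [a|] [->] /=.
- by case: xy => ->; exists None; rewrite ?mem_adjI_None.
- by exists (Some a); [rewrite mem_adjI_Some|case: a {aA}].
Qed.

Lemma leR_adjI_None x : leR (adjI A) None (Some x) = false.
Proof. by apply/exists_inP=> -[[[y|]|]]. Qed.

Lemma leR_smul_weak_inverse x a : a \in A -> leR A x (x ** a) ->
  exists b, [/\ b \in A, b ** a ** b = b & x ** a ** b = x].
Proof.
move=> aA le_x_xa.
have [b bA xab] : exists2 b, b \in A & x ** (a ** b) = x.
  case/exists_inP: le_x_xa => -[b|]; rewrite ?mem_adjI_Some => bA /eqP /= xE.
    by exists b; rewrite // smulA -xE.
  by exists a; rewrite // smulA -!xE.
set c := a ** b in xab; have cA : c \in A by apply: mulA.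
have [n /eqP idc] := ex_idem_pow1 c.
pose w := pow1 c (n + n); have wA : w \in A by apply: mem_pow1.
have cw_idem : c ** w ** (c ** w) = c ** w by rewrite -[c ** w]pow1D !idc.
have cwA : c ** w \in A by apply: mulA.
exists (b ** w ** (c ** w)).
have abw : a ** (b ** w ** (c ** w)) = c ** w by rewrite !smulA in cw_idem *.
split; first by rewrite !mulA.
  by rewrite -smulA abw -smulA cw_idem.
by rewrite -smulA abw; apply: (smul_pow1_id (n + n).+1).
Qed.

End GreenR.

Section GroupKernel.
Variables (T : finSemigroupType) (A : {set T}).
Implicit Types x a b : T.

Lemma group_kernelP x : reflect
  (x \in A /\ forall (gT : finGroupType) (rho : {set T * gT}),
     onto_subsemigroup A rho -> (x, 1) \in rho)
  (x \in group_kernel A).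
Proof. by rewrite inE; apply: (iffP andP) => -[xA] /asboolP. Qed.

Lemma group_kernel_sub : group_kernel A \subset A.
Proof. by apply/subsetP=> x /group_kernelP[]. Qed.

Lemma onto_subsemigroup_lift (gT : finGroupType) (rho : {set T * gT}) x :
  onto_subsemigroup A rho -> x \in A -> exists h, (x, h) \in rho.
Proof. by case=> <- _ /imsetP[[y h] yh ->]; exists h. Qed.

Lemma group_kernel_weak_inverse a b :
  a \in group_kernel A -> b \in A -> b ** a ** b = b -> b \in group_kernel A.
Proof.
move=> /group_kernelP[_ aK] bA bab; apply/group_kernelP; split=> // gT rho rhoA.
have [h bh] := onto_subsemigroup_lift rhoA bA.
have b_pow m : (b, h ^+ m.+1) \in rho.
  elim: m => // m IHm; have := rhoA.2 _ _ (rhoA.2 _ _ bh (aK _ _ rhoA)) IHm.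
  by rewrite /= bab mulg1 -expgS.
by have := b_pow #[h].-1; rewrite prednK ?order_gt0 // expg_order.
Qed.

End GroupKernel.

Lemma group_kernelS (T : finSemigroupType) (A B : {set T}) :
  smul_closed A -> A \subset B -> group_kernel A \subset group_kernel B.
Proof.
move=> mulA sAB; apply/subsetP=> x /group_kernelP[xA xK]; apply/group_kernelP.
split=> [|gT rho rhoB]; first exact: (subsetP sAB).
suff /xK : onto_subsemigroup A [set p in rho | p.1 \in A] by rewrite inE => /andP[].
split=> [|p q]; last first.
  by rewrite !inE => /andP[pr pA] /andP[qr qA]; rewrite rhoB.2 ?mulA.
apply/setP=> y; apply/imsetP/idP=> [[p]|yA]; first by rewrite inE => /andP[_ pA] ->.
have [h yh] := onto_subsemigroup_lift rhoB (subsetP sAB y yA).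
by exists (y, h); rewrite // inE yh.
Qed.

Section TypeIIClasses.
Variables (T : finSemigroupType) (A : {set T}).
Implicit Types x y a : T.

Lemma eqII_refl x : eqII A x x.
Proof.
by apply/andP; split; apply/exists_inP; exists None; rewrite ?mem_adjI_None.
Qed.

Lemma mem_classII x : x \in A -> x \in classII A x.
Proof. by move=> xA; rewrite inE xA eqII_refl. Qed.

Lemma eqII_eqR x y : eqII A x y -> eqR A x y.
Proof.
have /subsetP sKA := adjIS (group_kernel_sub A).
case/andP=> /exists_inP[a /sKA aA /eqP xy] /exists_inP[b /sKA bA /eqP yx].
apply/andP; split; apply/exists_inP.
  by exists b; rewrite ?yx.
by exists a; rewrite ?xy.
Qed.

Hypothesis mulA : smul_closed A.

Lemma leR_smul_eqII x a :
  a \in group_kernel A -> leR A x (x ** a) -> eqII A x (x ** a).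
Proof.
move=> aK; have aA := subsetP (group_kernel_sub A) a aK.
case/(leR_smul_weak_inverse mulA aA) => b [bA bab xab].
apply/andP; split; apply/exists_inP.
  by exists (Some a); rewrite ?mem_adjI_Some.
exists (Some b); last by rewrite /= xab.
by rewrite mem_adjI_Some (group_kernel_weak_inverse aK).
Qed.

Lemma quoII_Rclass_inj x y pi :
  pi \in quoII A (Rclass A x) -> pi \in quoII A (Rclass A y) ->
  Rclass A x = Rclass A y.
Proof.
move=> /imsetP[u ux ->] /imsetP[v vy uv]; move: ux vy.
rewrite !inE => /andP[uA xu] /andP[vA yv].
have : u \in classII A v by rewrite -uv mem_classII.
rewrite inE uA => /eqII_eqR vu.
by rewrite (eq_Rclass mulA xu) (eq_Rclass mulA yv) (eq_Rclass mulA vu).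
Qed.

End TypeIIClasses.

Lemma classIIS (T : finSemigroupType) (A B : {set T}) x :
  smul_closed A -> A \subset B -> classII A x \subset classII B x.
Proof.
move=> mulA sAB; have /subsetP sK := adjIS (group_kernelS mulA sAB).
apply/subsetP=> y; rewrite !inE => /andP[yA].
case/andP=> /exists_inP[a /sK aK xy] /exists_inP[b /sK bK yx].
rewrite (subsetP sAB) //=; apply/andP.
by split; apply/exists_inP; [exists a|exists b].
Qed.

Section Activators.
Variables (T : finSemigroupType) (A : {set T}).
Implicit Types (x s a : T) (t : option T).

Lemma calF_adjI x t : t \in calF A x -> t \in adjI A.
Proof. by rewrite !inE => /andP[/andP[]]. Qed.

Lemma calF_mulI x t : t \in calF A x -> mulI x t = x.
Proof. by rewrite inE => /and4P[_ /eqP]. Qed.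

Lemma calF_leR x t s : t \in calF A x -> s \in A ->
  leR A x (x ** s) = leR (adjI A) t (t ** Some s).
Proof.
rewrite inE => /and4P[_ _ /forall_inP ltR_xt _] sA; apply: negb_inj.
by rewrite -!ltR_mulr ?mem_adjI_Some //; apply/eqP/ltR_xt.
Qed.

Hypothesis mulA : smul_closed A.

Lemma calF_eqII x t a : t \in calF A x -> a \in group_kernel A ->
  leR A x (x ** a) -> exists2 f, t = Some f & eqII A f (f ** a).
Proof.
move=> tF aK; have aA := subsetP (group_kernel_sub A) a aK.
rewrite (calF_leR tF aA); case: t {tF} => [f|]; last by rewrite leR_adjI_None.
by rewrite leR_adjI_Some; exists f => //; apply: leR_smul_eqII.
Qed.

End Activators.

Section PowerSemigroupOrder.
Variable S : finSemigroupType.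
Implicit Types X Y : {set S}.

Lemma set_smul_neq0 X Y : X != set0 -> Y != set0 -> X ** Y != set0.
Proof.
move=> /set0Pn[x xX] /set0Pn[y yY]; apply/set0Pn; exists (x ** y).
exact: imset2_f.
Qed.

Lemma sub_smul_omega X Y : X \subset X ** Y -> X ** Y \subset X ** omega Y.
Proof.
move=> sXY; rewrite /omega; elim: (ex_minn _) => //= n; rewrite smulA.
by move=> /subset_trans; apply; apply: imset2S.
Qed.

Lemma sub_cover_classII (K : {set {set S}}) X :
  X \in K -> X \subset cover (classII K X).
Proof. by move=> XK; apply: (bigcup_sup X); rewrite ?mem_classII. Qed.

End PowerSemigroupOrder.

Section Complexes.
Variable S : finSemigroupType.
Implicit Types (K : {set {set S}}) (X Y : {set S}).

Lemma is_complexP K : reflect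
  [/\ {in K, forall X, X != set0}, forall s, [set s] \in K, smul_closed K
    & {in K, forall X Y, Y != set0 -> Y \subset X -> Y \in K}]
  (is_complex K).
Proof.
apply: (iffP and4P) => [[]|[K_ne K1 mulK subK]].
  move=> /subsetP K_ne /forallP K1 /forall_inP mulK /forall_inP subK.
  split=> // [X /K_ne|X Y /mulK/forall_inP|X /subK/forall_inP subX Y Y_ne].
  - by rewrite inE.
  - exact.
  - by apply/implyP/subX; rewrite inE.
split; first by apply/subsetP=> X /K_ne; rewrite inE.
- exact/forallP.
- by apply/forall_inP=> X XK; apply/forall_inP=> Y; apply: mulK.
- apply/forall_inP=> X XK; apply/forall_inP=> Y; rewrite inE => Y_ne.
  by apply/implyP; apply: subK.
Qed.

Lemma bigcap_complex (P : pred {set {set S}}) K :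
  P K -> (forall L, P L -> is_complex L) -> is_complex (\bigcap_(L | P L) L).
Proof.
move=> PK P_complex; apply/is_complexP; split=> [X /bigcapP/(_ K PK)|s|X Y|X].
- by have /is_complexP[K_ne _ _ _] := P_complex K PK; apply: K_ne.
- by apply/bigcapP=> L /P_complex/is_complexP[].
- move=> /bigcapP XP /bigcapP YP; apply/bigcapP=> L PL.
  have /is_complexP[_ _ mulL _] := P_complex L PL.
  by apply: mulL; [apply: XP|apply: YP].
- move=> /bigcapP XP Y Y_ne sYX; apply/bigcapP=> L PL.
  have /is_complexP[_ _ _ subL] := P_complex L PL.
  exact: subL (XP L PL) Y Y_ne sYX.
Qed.

Lemma nePow_ER_complex : is_ER_complex (nePow S).
Proof.
apply/andP; split.
  apply/is_complexP; split=> [X|s|X Y|X XP Y]; rewrite ?inE //.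
    by apply/set0Pn; exists s; rewrite inE.
  exact: set_smul_neq0.
apply/forall_inP=> X XP; apply/implyP=> _; rewrite inE.
by apply: subset_neq0 (sub_cover_classII XP) _; rewrite inE in XP.
Qed.

Lemma CER_complex : is_complex (CER S).
Proof. by apply: bigcap_complex nePow_ER_complex _ => K /andP[]. Qed.

Lemma CER_neq0 X : X \in CER S -> X != set0.
Proof. by have /is_complexP[C_ne _ _ _] := CER_complex; apply: C_ne. Qed.

Lemma CER_set1 s : [set s] \in CER S.
Proof. by have /is_complexP[_ C1 _ _] := CER_complex. Qed.

Lemma CER_smul : smul_closed (CER S).
Proof. by have /is_complexP[_ _ mulC _] := CER_complex. Qed.

Lemma CER_beta X : X \in CER S -> idem X -> beta X \in CER S.
Proof.
move=> XC idX; apply/bigcapP=> K ER_K.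
have sCK : CER S \subset K by apply: bigcap_inf.
have /andP[/is_complexP[_ _ _ subK] /forall_inP/(_ X (subsetP sCK X XC))] := ER_K.
move=> /implyP/(_ idX) beta_KX; apply: subK beta_KX _ _ _.
  exact: subset_neq0 (sub_cover_classII XC) (CER_neq0 XC).
(* The type-II class of [X] can only grow from [C] to the larger [K]. *)
apply/bigcupsP=> Y YX; apply: (bigcup_sup Y) => //.
exact: (subsetP (classIIS _ CER_smul sCK)).
Qed.

End Complexes.

Section FlowAutomata.
Variables (S : finSemigroupType) (St : finType) (Q : {set St}) (iota : St).
Variable Phi : St -> {set S}.

Lemma is_flow_is_flow_automaton (step : St -> S -> St) :
  iota \in Q -> is_flow Q iota step Phi -> is_flow_automaton Q iota step Phi.
Proof.
move=> iotaQ flow; split=> //; split=> // q s qQ.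
by case: flow => _ /(_ q s qQ) /setD1P[].
Qed.

Lemma Cov_sub_complex (K : {set {set S}}) : is_complex K ->
  {in Q :\ iota, forall q, Phi q \in K} -> Cov Q iota Phi \subset K.
Proof.
case/is_complexP=> _ _ _ subK PhiK; apply/subsetP=> X.
rewrite !inE => /andP[X_ne /exists_inP[q qQ sX]].
exact: subK (PhiK q qQ) X X_ne sX.
Qed.

End FlowAutomata.

Section Closure.
Variables (S : finSemigroupType) (E : {set S} -> option {set S}).
Hypothesis hE : idempotent_choice E.
Implicit Types X Y F : {set S}.
Local Notation C := (CER S).
Local Notation psi := (psi E).
Local Notation bar := (bar E).
Local Notation FF := (FF E).

Lemma psi_None X : E X = None -> psi X = X.
Proof. by move=> EX; rewrite /Defs.psi EX omega_None. Qed.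

Lemma psi_Some X F : E X = Some F -> psi X = X ** omega (beta F).
Proof. by move=> EX; rewrite /Defs.psi EX omega_Some. Qed.

Lemma idempotent_choice_Some X F :
  X \in C -> E X = Some F -> [/\ F \in C, X ** F = X & idem F].
Proof.
move=> XC EX; have [] := hE XC; rewrite EX => EF /eqP[idF] _.
split; [|exact: (calF_mulI EF)|exact/eqP].
by rewrite -mem_adjI_Some (calF_adjI EF).
Qed.

Lemma sub_smul_beta X F : X \in C -> E X = Some F -> X \subset X ** beta F.
Proof.
move=> XC EX; have [FC XF _] := idempotent_choice_Some XC EX.
by rewrite -{1}XF imset2S // sub_cover_classII.
Qed.

Lemma smul_beta_sub_psi X F : X \in C -> E X = Some F -> X ** beta F \subset psi X.
Proof. by move=> XC EX; rewrite (psi_Some EX) sub_smul_omega // sub_smul_beta. Qed.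

Lemma mem_psi : {homo psi : X / X \in C}.
Proof.
move=> X XC; case EX: (E X) => [F|]; last by rewrite psi_None.
have [FC _ idF] := idempotent_choice_Some XC EX.
by rewrite (psi_Some EX) CER_smul ?mem_omega ?CER_beta //; apply: CER_smul.
Qed.

Lemma sub_psi : {in C, forall X, X \subset psi X}.
Proof.
move=> X XC; case EX: (E X) => [F|]; last by rewrite psi_None.
exact: subset_trans (sub_smul_beta XC EX) (smul_beta_sub_psi XC EX).
Qed.

Lemma beta_sub_psi X : X \in C -> beta X \subset psi X.
Proof.
move=> XC; apply/bigcupsP=> Y; rewrite inE => /andP[_ XY].
have /andP[leXY _] := eqII_eqR XY.
case/andP: XY => /exists_inP[[a|] aK /eqP /= YE] _; last by rewrite -YE sub_psi.
rewrite mem_adjI_Some in aK; rewrite -YE in leXY *.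
have [EX _ _] := hE XC; have [F EF F_Fa] := calF_eqII (@CER_smul S) EX aK leXY.
have [FC XF _] := idempotent_choice_Some XC EF.
apply: subset_trans (smul_beta_sub_psi XC EF).
rewrite -{1}XF -smulA imset2S //; apply: (bigcup_sup (F ** a)) => //.
by rewrite inE F_Fa CER_smul // (subsetP (group_kernel_sub C)).
Qed.

Lemma sub_bar X : X \in C -> X \subset bar X.
Proof.
apply: (omega_extensive (r := fun X Y => X \subset Y) _ _ mem_psi sub_psi) => //.
by move=> Z Y W; apply: subset_trans.
Qed.

Lemma bar_FF X : X \in C -> bar X \in FF.
Proof.
move=> XC; rewrite inE (mem_omega_ffun mem_psi XC); apply/eqP.
apply: (omega_extensive_fixed (r := fun X Y => X \subset Y) _ _ mem_psi) => //.
- by move=> Z Y W; apply: subset_trans.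
- exact: sub_psi.
- by move=> Y Z sYZ; apply/eqP; rewrite eqEsubset.
Qed.

Lemma FF_CER X : X \in FF -> X \in C.
Proof. by rewrite inE => /andP[]. Qed.

Lemma beta_FF X : X \in FF -> beta X = X.
Proof.
rewrite inE => /andP[XC /eqP psiX]; apply/eqP.
by rewrite eqEsubset sub_cover_classII // -{2}psiX beta_sub_psi.
Qed.

Section Automaton.
Variable g : S -> {set {set S}} -> {perm {set {set S}}}.
Hypothesis hg : permutation_choice g.
Local Notation scrR_index := {P | P \in scrR E}.
Implicit Types (d h k : prodG E) (R : scrR_index) (pi : {set {set S}}).
Local Notation GG := (GG E g).
Local Notation gen := (gen E g).
Local Notation QS := (QS E g).
Local Notation iotaS := (iotaS E).
Local Notation stepS := (stepS E g).
Local Notation PhiS := (PhiS E).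

Lemma scrR_Rclass R : val R \in [set Rclass C X | X in C].
Proof. by have /imsetP[X /FF_CER XC ->] := valP R; apply: imset_f. Qed.

Lemma FF_component X : X \in FF ->
  exists2 R : scrR_index, val R = Rclass C X & classII C X \in quoII C (val R).
Proof.
move=> XF; have RX : Rclass C X \in scrR E by apply: imset_f.
exists (exist (fun P => P \in scrR E) _ RX) => //=.
by rewrite imset_f // mem_Rclass // FF_CER.
Qed.

Lemma odotE R pi h : pi \in quoII C (val R) -> odot pi h = h R pi.
Proof.
move=> piR; rewrite /odot; case: pickP => [P piP|/(_ R)]; last by rewrite piR.
congr (h _ pi); apply: val_inj; move: piR piP.
have [/imsetP[X _ ->] /imsetP[Y _ ->]] := (scrR_Rclass R, scrR_Rclass P).
by move=> piX piY; apply: quoII_Rclass_inj piY piX; apply: CER_smul.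
Qed.

Lemma GG_sub_setXn :
  GG \subset setXn (fun R : scrR_index => Sym (quoII C (val R))).
Proof.
rewrite gen_subG; apply/subsetP=> _ /imsetP[s _ ->]; apply/setXnP=> R.
by rewrite ffunE; have [] := hg s (scrR_Rclass R).
Qed.

Lemma GG_quoII R pi h :
  h \in GG -> (h R pi \in quoII C (val R)) = (pi \in quoII C (val R)).
Proof.
by move=> /(subsetP GG_sub_setXn)/setXnP/(_ R); rewrite inE => /perm_closed ->.
Qed.

Lemma odotM pi h k : h \in GG -> odot pi (h * k) = odot (odot pi h) k.
Proof.
move=> hG; have [R piR|out] := pickP (fun R => pi \in quoII C (val R)).
  by rewrite (odotE h piR) !(@odotE R) ?GG_quoII // ffunE permM.
have odot_out (l : prodG E) : odot pi l = pi.
  by rewrite /odot; case: pickP => // R; rewrite out.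
by rewrite !odot_out.
Qed.

Lemma odot1 pi : odot pi (1 : prodG E) = pi.
Proof. by rewrite /odot; case: pickP => // R _; rewrite ffunE perm1. Qed.

Lemma gen_GG s : gen s \in GG.
Proof. exact/mem_gen/imset_f. Qed.

Lemma odot_gen X s : X \in FF -> eqR C (X ** [set s]) X ->
  odot (classII C X) (gen s) = classII C (X ** [set s]).
Proof.
move=> XF XsX; have XC := FF_CER XF; have [R RX piR] := FF_component XF.
rewrite (odotE _ piR) ffunE; have [_] := hg s (scrR_Rclass R); apply => //.
exists X; first exact: mem_classII.
by rewrite RX inE CER_smul ?CER_set1 // eqR_sym.
Qed.

Lemma in_QS_diag X h : X \in FF -> h \in GG -> in_QS g X h h.
Proof. by move=> XF hG; rewrite /in_QS XF hG mulVg odot1 imset_f. Qed.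

Lemma value_diag X h : X \in FF -> value X h h = X.
Proof. by move=> XF; rewrite /value mulVg odot1 -/(beta X) beta_FF. Qed.

Lemma classII_value X d h : in_QS g X d h ->
  odot (classII C X) (d^-1 * h) = classII C (value X d h).
Proof.
by case/and4P=> _ _ _ /imsetP[V VF piV]; rewrite /value piV -/(beta V) beta_FF.
Qed.

Lemma value_FF X d h : in_QS g X d h -> value X d h \in FF.
Proof.
by case/and4P=> _ _ _ /imsetP[V VF piV]; rewrite /value piV -/(beta V) beta_FF.
Qed.

Lemma value_gen X d h s : in_QS g X d h ->
  eqR C (value X d h ** [set s]) (value X d h) ->
  value X d (h * gen s) = beta (value X d h ** [set s]).
Proof.
move=> qQ VsV; have /and4P[_ dG hG _] := qQ.
rewrite {1}/value mulgA odotM ?groupM ?groupV //.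
by rewrite classII_value // odot_gen // value_FF.
Qed.

Lemma value_smul_CER X d h s : in_QS g X d h -> value X d h ** [set s] \in C.
Proof. by move=> qQ; rewrite CER_smul ?CER_set1 // FF_CER // value_FF. Qed.

Lemma iotaS_QS : iotaS \in QS.
Proof. by rewrite inE. Qed.

Lemma stepS_QS q s : q \in QS -> stepS q s \in QS :\ iotaS.
Proof.
case: q => [[[X d] h]|]; rewrite !inE /= => qQ; last first.
  by apply: in_QS_diag (gen_GG s); apply/bar_FF/CER_set1.
rewrite /lambda; case: ifP => [/andP[_] //|_]; have /and4P[_ _ hG _] := qQ.
by apply: in_QS_diag; rewrite ?groupM ?gen_GG // bar_FF // value_smul_CER.
Qed.

Lemma PhiS_CER q : q \in QS :\ iotaS -> PhiS q \in C.
Proof. by case: q => [[[X d] h]|]; rewrite !inE // => /value_FF/FF_CER. Qed.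

Lemma mem_PhiS_stepS_iotaS s : s \in PhiS (stepS iotaS s).
Proof.
rewrite /= value_diag ?bar_FF ?CER_set1 //.
by rewrite -sub1set sub_bar // CER_set1.
Qed.

Lemma PhiS_stepS q s :
  q \in QS :\ iotaS -> PhiS q ** [set s] \subset PhiS (stepS q s).
Proof.
case: q => [[[X d] h]|]; rewrite !inE // => qQ /=.
have VsC := value_smul_CER s qQ.
rewrite /lambda; case: ifP => [/andP[VsV _]|_] /=.
  by rewrite value_gen // sub_cover_classII.
by rewrite value_diag ?bar_FF ?sub_bar.
Qed.

End Automaton.
End Closure.

Theorem proposition7p12 (S : finSemigroupType)
    (E : {set S} -> option {set S})
    (g : S -> {set {set S}} -> {perm {set {set S}}})
    (hE : idempotent_choice E) (hg : permutation_choice g) :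
  [/\ is_flow (QS E g) (iotaS E) (stepS E g) (PhiS E),
      is_flow_automaton (QS E g) (iotaS E) (stepS E g) (PhiS E)
    & Cov (QS E g) (iotaS E) (PhiS E) \subset CER S].
Proof.
have flow : is_flow (QS E g) (iotaS E) (stepS E g) (PhiS E).
  split=> [q qQ|q s qQ|s|q s qQ].
  - by rewrite inE CER_neq0 // (PhiS_CER hE qQ).
  - exact: stepS_QS.
  - exact: mem_PhiS_stepS_iotaS.
  - exact: PhiS_stepS.
split=> //; first exact: is_flow_is_flow_automaton (iotaS_QS E g) flow.
by apply: Cov_sub_complex (CER_complex S) _ => q; apply: PhiS_CER.
Qed.
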